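(* Suppose $D\subset\mathbb{R}^d$ is a compact set, $x\in D$, the vector $u\in\mathbb{R}^d$ has unit length, $\beta_1$ and $\beta_2$ are positive constants, $s\in[\frac12,1]$, and furthermore $$\{x+\delta u+\lambda\delta^{s}v:\ \delta\in[0,\beta_1],\ \lambda\in[0,\beta_2],\ v\in\mathbb{R}^d,\ |v|=1,\ u\perp v\}\subset D.$$ Then $$C(\mathcal{P}_n,D,x)\le c\,n^{2+2s(d-1)},\quad n\ge 1,$$ where $c$ depends only on $\beta_1$, $\beta_2$, and $d$.
   Context: $|\cdot|$ is the Euclidean norm. $\mathcal{P}_n=\mathcal{P}_{n,d}$ is the space of real algebraic polynomials in $d$ variables of total degree $\le n$. For a compact set $D\subset\mathbb{R}^d$ of positive Lebesgue measure and $x\in\mathbb{R}^d$, $C(\mathcal{P}_n,D,x)=\sum_{k=1}^N\phi_k(x)^2$, where $\{\phi_k\}_{k=1}^N$ is any basis of $\mathcal{P}_n$ that is orthonormal in $L_2(D)$ with respect to Lebesgue measure (the value does not depend on the choice of the orthonormal basis).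
   Formalization: The dimension is assumed to satisfy d ≥ 2: for d = 1 no unit v is orthogonal to u, the assumed set is empty, and the claim fails (D = [0,ε], x = 0 gives C ≥ 1/ε, unbounded as ε → 0); for d = 0 there is no unit vector u. *)

(* Defs.v *)
From HB Require Import structures.
From mathcomp Require Import all_boot all_order all_algebra.
(* mpoly's notations clash with those of analysis; without them, its
   abbreviations [msize p], {mpoly R[d]} and p.@[v] are written
   [mmeasure mdeg p], [mpoly d R] and [meval v p]. *)
From mathcomp Require Import -(notations) mpoly.
From mathcomp Require Import all_classical all_reals all_analysis.

Set Implicit Arguments.
Unset Strict Implicit.
Unset Printing Implicit Defensive.

Import Order.TTheory GRing.Theory Num.Theory.
Import numFieldNormedType.Exports.

Local Open Scope classical_set_scope.
Local Open Scope ring_scope.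

Section Euclidean.
Context {R : realType} {d : nat}.
Implicit Types u v : 'rV[R]_d.

Definition dotv u v : R := \sum_(i < d) u ord0 i * v ord0 i.

(* `|u| on 'rV[R]_d is the sup norm. *)
Definition enorm u : R := Num.sqrt (dotv u u).

End Euclidean.

Fact rV_display : measure_display.
Proof. exact: default_measure_display. Qed.

Section RowVectorMeasurable.
Context {R : realType} {d : nat}.

Let coors (i : 'I_d) (v : 'rV[R]_d) : measurableTypeR R := v ord0 i.

Let rV_set0 : g_sigma_preimage coors set0.
Proof. exact: sigma_algebra0. Qed.

Let rV_setC A : g_sigma_preimage coors A -> g_sigma_preimage coors (~` A).
Proof. exact: sigma_algebraC. Qed.

Let rV_bigcup (F : _^nat) : (forall i, g_sigma_preimage coors (F i)) ->
  g_sigma_preimage coors (\bigcup_i (F i)).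
Proof. exact: sigma_algebra_bigcup. Qed.

(* The Borel sigma-algebra of R^d, generated by the coordinate functions. *)
HB.instance Definition _ := @isMeasurable.Build rV_display
  'rV[R]_d (g_sigma_preimage coors) rV_set0 rV_setC rV_bigcup.

Lemma measurable_coord (i : 'I_d) :
  measurable_fun [set: 'rV[R]_d]
    (fun v : 'rV[R]_d => v ord0 i : measurableTypeR R).
Proof.
move=> _ Y mY; rewrite setTI; apply: sub_sigma_algebra => /=.
rewrite -bigcup_seq/=; exists i => /=; first by rewrite mem_index_enum.
by exists Y => //; rewrite setTI.
Qed.

Lemma measurable_fun_rVP d1 (T : measurableType d1) (f : T -> 'rV[R]_d) :
  (forall i, measurable_fun [set: T] (fun t => f t ord0 i : measurableTypeR R))
  -> measurable_fun [set: T] f.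
Proof.
move=> mf; suff : g_sigma_preimage (fun i => coors i \o f) `<=` measurable.
  by rewrite g_sigma_preimage_comp => sub _ A mA; apply: sub; exists A.
apply: smallest_sub; first exact: sigma_algebra_measurable.
rewrite -bigcup_seq => A [i _] [B mB <-]; exact: mf.
Qed.

End RowVectorMeasurable.

Section Cons.
Context {R : realType} {d : nat}.

Definition consv (p : measurableTypeR R * 'rV[R]_d) : 'rV[R]_d.+1 :=
  row_mx (p.1)%:M p.2.

Definition unconsv (v : 'rV[R]_d.+1) : measurableTypeR R * 'rV[R]_d :=
  (v ord0 ord0, \row_i v ord0 (lift ord0 i)).

Lemma consv0 p : consv p ord0 ord0 = p.1.
Proof.
have -> : (ord0 : 'I_d.+1) = lshift d (ord0 : 'I_1) by exact: val_inj.
by rewrite [LHS]row_mxEl mxE mulr1n.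
Qed.

Lemma consvS p i : consv p ord0 (lift ord0 i) = p.2 ord0 i.
Proof.
have -> : lift ord0 i = rshift 1 i by exact: val_inj.
exact: row_mxEr.
Qed.

Lemma consvK : cancel consv unconsv.
Proof.
move=> p; rewrite /unconsv consv0 [RHS]surjective_pairing; congr pair.
by apply/rowP => i; rewrite mxE consvS.
Qed.

Lemma unconsvK : cancel unconsv consv.
Proof.
move=> v; apply/rowP => i; have [j ->|->] := unliftP ord0 i.
  by rewrite consvS mxE.
by rewrite consv0.
Qed.

Lemma measurable_consv : measurable_fun setT consv.
Proof.
apply: measurable_fun_rVP => i; have [j ->|->] := unliftP ord0 i.
  apply: (eq_measurable_fun (fun p : measurableTypeR R * 'rV[R]_d => p.2 ord0 j : measurableTypeR R)).
    by move=> p _; rewrite consvS.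
  exact: (measurableT_comp (measurable_coord j)).
apply: (eq_measurable_fun fst); last exact: measurable_fst.
by move=> p _; rewrite consv0.
Qed.

Lemma measurable_unconsv : measurable_fun setT unconsv.
Proof.
apply: measurable_fun_pair; first exact: measurable_coord.
apply: measurable_fun_rVP => i /=.
apply: (eq_measurable_fun
  (fun v : 'rV[R]_d.+1 => v ord0 (lift ord0 i) : measurableTypeR R)).
  by move=> v _; rewrite mxE.
exact: measurable_coord.
Qed.

End Cons.

Section LebesgueCons.
Local Open Scope ereal_scope.
Context {R : realType} {d : nat}.
Variable mu : {sigma_finite_measure set 'rV[R]_d -> \bar R}.

(* The product measure (Lebesgue measure on R) x mu, carried to R^(d+1). *)
Definition lebesgue_cons : set 'rV[R]_d.+1 -> \bar R :=
  pushforward (@lebesgue_measure R \x mu) consv.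

Let lebesgue_cons0 : lebesgue_cons set0 = 0.
Proof. by rewrite /lebesgue_cons /pushforward preimage_set0 measure0. Qed.

Let lebesgue_cons_ge0 A : 0 <= lebesgue_cons A.
Proof. by rewrite /lebesgue_cons /pushforward measure_ge0. Qed.

Let lebesgue_cons_sigma_additive : semi_sigma_additive lebesgue_cons.
Proof.
move=> F mF tF mUF; rewrite /lebesgue_cons /pushforward preimage_bigcup.
apply: measure_semi_sigma_additive.
- by move=> n; rewrite -[X in measurable X]setTI; exact: measurable_consv.
- apply/trivIsetP => /= i j _ _ ij; rewrite -preimage_setI.
  by move/trivIsetP : tF => /(_ _ _ _ _ ij) ->//; rewrite preimage_set0.
- rewrite -preimage_bigcup -[X in measurable X]setTI.
  exact: measurable_consv.
Qed.

HB.instance Definition _ := isMeasure.Build _ _ _ lebesgue_cons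
  lebesgue_cons0 lebesgue_cons_ge0 lebesgue_cons_sigma_additive.

Let lebesgue_cons_sigma_finite : sigma_finite setT lebesgue_cons.
Proof.
have /sigma_finiteP[F [TF ndF Foo]] := sigma_finiteT (@lebesgue_measure R).
have /sigma_finiteP[G [TG ndG Goo]] := sigma_finiteT mu.
exists (fun k => unconsv @^-1` (F k `*` G k)).
  apply/esym/seteqP; split => // v _.
  have [n _ Fn] : (\bigcup_n F n) (unconsv v).1 by rewrite -TF.
  have [k _ Gk] : (\bigcup_n G n) (unconsv v).2 by rewrite -TG.
  exists (maxn n k) => //; split => /=.
    by move: Fn; exact/subsetPset/ndF/leq_maxl.
  by move: Gk; exact/subsetPset/ndG/leq_maxr.
move=> k; have [mF Fk] := Foo k; have [mG Gk] := Goo k; split.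
  rewrite -[X in measurable X]setTI; apply: measurable_unconsv => //.
  exact: measurableX.
rewrite /lebesgue_cons /pushforward (_ : _ @^-1` _ = F k `*` G k).
  by rewrite product_measure1E// lte_mul_pinfty// ge0_fin_numE.
by apply/funext => p; rewrite /preimage/mkset consvK.
Qed.

HB.instance Definition _ := Measure_isSigmaFinite.Build _ _ _ lebesgue_cons
  lebesgue_cons_sigma_finite.

End LebesgueCons.

Fixpoint lebesgue_rV (R : realType) (d : nat) :
    {sigma_finite_measure set 'rV[R]_d -> \bar R} :=
  if d is k.+1 then lebesgue_cons (lebesgue_rV R k) else \d_ (0 : 'rV[R]_0).

Section Box.
Local Open Scope ereal_scope.
Context {R : realType}.

Lemma measurable_box d (A : 'I_d -> set (measurableTypeR R)) :
  (forall i, measurable (A i)) ->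
  measurable [set v : 'rV[R]_d | forall i, A i (v ord0 i)].
Proof.
move=> mA; rewrite (_ : mkset _ = \bigcap_(i in [set: 'I_d])
    ((fun v : 'rV[R]_d => v ord0 i : measurableTypeR R) @^-1` A i)).
  apply: fin_bigcap_measurable => [|i _]; first exact: finite_finset.
  by rewrite -[X in measurable X]setTI; exact: measurable_coord.
by apply/seteqP; split => v /= Av i => [_|]; exact: Av.
Qed.

(* The defining property of Lebesgue measure. *)
Lemma lebesgue_rV_box d (A : 'I_d -> set (measurableTypeR R)) :
  (forall i, measurable (A i)) ->
  lebesgue_rV R d [set v | forall i, A i (v ord0 i)] =
  \prod_(i < d) lebesgue_measure (A i).
Proof.
elim: d => [|d IH] in A *; move=> mA.
  by rewrite big_ord0 /= diracE mem_set// => -[].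
rewrite big_ord_recl -IH// /= -product_measure1E//; last first.
  exact: (measurable_box (A := fun i => A (lift ord0 i))).
rewrite /lebesgue_cons /pushforward; congr (_ _).
apply/seteqP; split => p /=.
- move=> Ap; split=> [|i]; first by rewrite -consv0; exact: Ap.
  by rewrite -consvS; exact: Ap.
- case=> A0 AS i; have [j ->|->] := unliftP ord0 i; first by rewrite consvS.
  by rewrite consv0.
Qed.

End Box.

Section Christoffel.
Context {R : realType} {d : nat}.

Definition evalp (p : mpoly d R) (y : 'rV[R]_d) : R :=
  meval (fun i => y ord0 i) p.

(* [mmeasure mdeg p] is 1 + the total degree of p, and 0 for p = 0. *)
Definition polys (n : nat) : set (mpoly d R) :=
  [set p | (mmeasure (@mdeg d) p <= n.+1)%N].

Definition is_basis (V : set (mpoly d R)) (N : nat) (phi : 'I_N -> mpoly d R) :=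
  (forall k, V (phi k)) /\
  (forall p, V p -> exists! a : 'rV[R]_N, p = \sum_(k < N) a ord0 k *: phi k).

Definition dotL2 (D : set 'rV[R]_d) (p q : mpoly d R) : R :=
  \int[lebesgue_rV R d]_(y in D) (evalp p y * evalp q y).

Definition orthonormal_in_L2 (D : set 'rV[R]_d) (N : nat)
    (phi : 'I_N -> mpoly d R) :=
  forall j k, dotL2 D (phi j) (phi k) = (j == k)%:R.

(* [is_christoffel n D x y] says that C(P_n, D, x) = y; the value does not
   depend on the orthonormal basis. *)
Definition is_christoffel (n : nat) (D : set 'rV[R]_d) (x : 'rV[R]_d) (y : R) :=
  exists (N : nat) (phi : 'I_N -> mpoly d R),
    [/\ is_basis (polys n) phi, orthonormal_in_L2 D phi
      & y = \sum_(k < N) evalp (phi k) x ^+ 2].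

End Christoffel.

(* Main.v *)
Require Import Defs.
From mathcomp Require Import all_boot all_order all_algebra.
From mathcomp Require Import all_fingroup finmap.
From mathcomp Require Import -(notations) mpoly.
From mathcomp Require Import all_classical all_reals all_analysis.
From mathcomp Require Import measurable_realfun.
From mathcomp Require Import ring lra.

(** Expanding the orthonormal basis at [x] gives a polynomial
[p = \sum_k phi_k(x) phi_k] of degree at most [n] with
[p(x) = \int_D p^2 = C(P_n, D, x)] ([christoffel_extremal]).  Any inequality
[p(x)^2 <= K \int_D p^2] therefore bounds the Christoffel function by [K], and
the proof establishes one with [K] of order [n^(2 + 2 s (d - 1))].

The horn contained in [D] has cross-section of radius [~ delta^s] at height
[delta] above [x].  Once heights below [h ~ n^(-2)] are discarded it contains a
set with polynomial geometry that does not depend on [s] up to a linear change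
of scale: since [s >= 1/2], [h^(s - 1/2) sqrt(delta) <= delta^s] for
[delta >= h], so the horn contains the truncated paraboloid of points
[x + delta u + r L(w)] with [h <= delta <= b], [|r| = a sqrt(delta)],
[a ~ h^(s - 1/2)], where [w] runs through the unit cube of [R^(d-1)] and [L]
is a linear parametrization of the hyperplane orthogonal to [u]
([paraboloid_sub_horn]).

For fixed [w], put [delta = t^2].  The polynomial
[t |-> p (x + t^2 u + t a L(w))] has degree at most [2 n], and its even part is
[A(t^2)] with [A] of degree at most [n] and [A(0) = p(x)]
([parabola_even_part]).  The two signs of [r] together control [A], because
[p_+^2 + p_-^2 >= 2 A^2].  In dimension one, [A(0)^2] is at most
[C n^2 \int_h^b A^2] although the integral stops short of [0]
([endpoint_nikolskii_gap]).  Integrating over [w] and paying the Jacobian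
[(a sqrt(delta))^(d-1) >= (a sqrt(h))^(d-1) ~ n^(-2 s (d-1))] of the slices
gives [integral_paraboloid_ge], and the two powers of [n] multiply to the
claimed one.

The remaining work is measure theory on row vectors: compact sets are
measurable, and Lebesgue measure, being determined by its values on boxes,
transforms as expected under homotheties, permutations of coordinates and the
shears that straighten the hyperplane orthogonal to [u]. *)

Set Implicit Arguments.
Unset Strict Implicit.
Unset Printing Implicit Defensive.

Import Order.TTheory GRing.Theory Num.Theory.
Import numFieldNormedType.Exports.

Local Open Scope classical_set_scope.
Local Open Scope ring_scope.

(** * Endpoint inequalities for univariate polynomials *)

Section PolynomialIntegral.
Context {R : realType}.
Implicit Types (p q : {poly R}) (a b c : R).

Definition primitive p : {poly R} :=
  \poly_(i < (size p).+1) (p`_i.-1 / i%:R).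

(** The integral of [p] over [[a, b]] through its antiderivative, so that linearity,
change of variable and integration by parts are algebra valid for all [a] and
[b]; [integral_poly] relates it to the Lebesgue integral. *)
Definition pint a b p : R := (primitive p).[b] - (primitive p).[a].

Lemma deriv_primitive p : (primitive p)^`() = p.
Proof.
apply/polyP => i; rewrite coef_deriv coef_poly ltnS.
case: ltnP => [_|pi]; last by rewrite mul0rn nth_default.
by rewrite /= -[LHS]mulr_natr divfK// pnatr_eq0.
Qed.

Lemma primitiveK p : primitive p^`() = p - (p`_0)%:P.
Proof.
apply/polyP => i; rewrite coefB coefC coef_poly.
case: i => [|i] /=; first by rewrite invr0 mulr0 subrr.
rewrite subr0 ltnS coef_deriv; case: ltnP => [_|pi].
  by rewrite -[X in X / _]mulr_natr mulfK// pnatr_eq0.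
have /eqP : p^`()`_i = 0 by exact: nth_default.
by rewrite coef_deriv mulrn_eq0 => /eqP.
Qed.

Lemma pint_deriv a b p : pint a b p^`() = p.[b] - p.[a].
Proof. by rewrite /pint primitiveK !hornerE opprB addrA subrK. Qed.

Lemma pintD a b p q : pint a b (p + q) = pint a b p + pint a b q.
Proof.
rewrite -{1}(deriv_primitive p) -{1}(deriv_primitive q) -derivD pint_deriv.
by rewrite /pint !hornerD; ring.
Qed.

Lemma pintZ a b c p : pint a b (c *: p) = c * pint a b p.
Proof.
rewrite -{1}(deriv_primitive p) -derivZ pint_deriv.
by rewrite /pint !hornerZ; ring.
Qed.

Lemma pint_cat a b c p : pint a b p + pint b c p = pint a c p.
Proof. by rewrite /pint; ring. Qed.

Lemma pint_by_parts a b p q :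
  pint a b (p * q^`()) = (p * q).[b] - (p * q).[a] - pint a b (p^`() * q).
Proof. by rewrite -pint_deriv derivM pintD addrC addKr. Qed.

Lemma pint_comp_affine a b p :
  (b - a) * pint 0 1 (p \Po (a%:P + (b - a) *: 'X)) = pint a b p.
Proof.
rewrite -pintZ -{1}(deriv_primitive p).
set l := a%:P + _.
have -> : (b - a) *: ((primitive p)^`() \Po l) = (primitive p \Po l)^`().
  by rewrite deriv_comp derivD derivC add0r derivZ derivX -scalerAr mulr1.
rewrite pint_deriv !horner_comp /l !hornerD !hornerC !hornerZ !hornerX /pint.
by congr (_.[_] - _.[_]); ring.
Qed.

Lemma integral_poly a b p : a < b ->
  (\int[lebesgue_measure]_(t in `[a, b]) (p.[t])%:E = (pint a b p)%:E)%E.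
Proof.
move=> ab; rewrite (@continuous_FTC2 _ _ (horner (primitive p)))//.
- by apply: continuous_subspaceT => t; exact: continuous_horner.
- split => [t _| |]; first exact: derivable_horner.
    by apply: cvg_at_right_filter; exact: continuous_horner.
  by apply: cvg_at_left_filter; exact: continuous_horner.
- by move=> t _; rewrite -derivE deriv_primitive.
Qed.

Lemma pint_ge0 a b p : a <= b -> (forall t, a <= t <= b -> 0 <= p.[t]) ->
  0 <= pint a b p.
Proof.
rewrite le_eqVlt => /predU1P[->|ab] p0; first by rewrite /pint subrr.
rewrite -lee_fin -integral_poly//; apply: integral_ge0 => t /=.
by rewrite in_itv/= lee_fin; exact: p0.
Qed.

Lemma pint_by_parts_iter n p q :
  (forall j, (j < n)%N -> q^`(j).[0] = 0 /\ q^`(j).[1] = 0) ->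
  pint 0 1 (p * q^`(n)) = (-1) ^+ n * pint 0 1 (p^`(n) * q).
Proof.
elim: n p => [|n IH] p q0; first by rewrite expr0 mul1r.
have [q0n q1n] := q0 n (ltnSn n).
rewrite derivnS pint_by_parts !hornerM q0n q1n !mulr0 subrr sub0r.
rewrite IH => [|j jn]; last by apply: q0; rewrite ltnS ltnW.
by rewrite -derivSn exprS; ring.
Qed.

(** Through a Rodrigues formula this weight yields [endpoint_kernel], the
reproducing kernel of evaluation at the endpoint [0] for polynomials of degree
at most [n] on [[0, 1]].  It vanishes to order [n + 1] at [1] but only to order
[n] at [0], so that integration by parts leaves exactly one boundary term, at
[0]. *)
Definition kernel_weight n : {poly R} := 'X^n * (1 - 'X) ^+ n.+1.

Definition endpoint_kernel n : {poly R} :=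
  - (n`!%:R^-1) *: (kernel_weight n)^`(n.+1).

Lemma derivn_kernel_weight0 n j : (j <= n)%N ->
  (kernel_weight n)^`(j).[0] = (j == n)%:R * n`!%:R.
Proof.
move=> jn; rewrite horner_coef0 coef_derivn addn0 coefXnM ltn_neqAle jn andbT.
case: eqVneq => [->|_]/=; last by rewrite mul0rn mul0r.
by rewrite subnn -horner_coef0 !hornerE subr0 expr1n ffactnn.
Qed.

Lemma derivn_kernel_weight1 n j : (j <= n)%N -> (kernel_weight n)^`(j).[1] = 0.
Proof.
rewrite -ltnS /kernel_weight; elim: j n.+1 'X^n => [|j IH] [|m] q // jm.
  by rewrite !hornerE subrr expr0n mulr0.
rewrite derivSn (_ : (_ * _)^`() =
    (q^`() * (1 - 'X) - m.+1%:R *: q) * (1 - 'X) ^+ m); first exact: IH.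
rewrite derivM deriv_exp derivB derivX -polyC1 derivC sub0r polyC1 /=.
rewrite exprS -mul_polyC polyCMn -mulr_natl; ring.
Qed.

(** The first integration by parts produces the boundary term [p(0) n!]; the next
[n] ones produce none, and end with the derivative of order [n + 1] of [p],
which is zero. *)
Lemma endpoint_kernelP n p : (size p <= n.+1)%N ->
  pint 0 1 (p * endpoint_kernel n) = p.[0].
Proof.
move=> pn; rewrite -scalerAr pintZ derivnS pint_by_parts.
rewrite pint_by_parts_iter; last first.
  move=> j jn; split; last exact/derivn_kernel_weight1/ltnW.
  by rewrite (derivn_kernel_weight0 (ltnW jn)) (ltn_eqF jn) mul0r.
rewrite -derivSn (derivn_poly0 pn) mul0r.
have -> : pint 0 1 (0 : {poly R}) = 0
  by rewrite -(scale0r (0 : {poly R})) pintZ mul0r.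
rewrite !hornerM (derivn_kernel_weight0 (leqnn n))
  (derivn_kernel_weight1 (leqnn n)).
rewrite eqxx !mulr0 mul1r sub0r subr0.
have : (n`!)%:R != 0 :> R by rewrite pnatr_eq0 -lt0n fact_gt0.
by move=> n0; field.
Qed.

Lemma endpoint_kernel0 n : (endpoint_kernel n).[0] = n.+1%:R ^+ 2.
Proof.
rewrite hornerZ horner_coef0 coef_derivn addn0 ffactnn coefXnM.
rewrite ltnNge leqnSn/= subSnn -[_`_1]mulr1n -(coef_deriv _ 0) -horner_coef0.
rewrite deriv_exp derivB derivX -polyC1 derivC sub0r hornerMn hornerM.
rewrite horner_exp hornerN hornerD hornerN hornerX hornerC subr0 expr1n mulr1.
have : (n`!)%:R != 0 :> R by rewrite pnatr_eq0 -lt0n fact_gt0.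
rewrite factS -(mulr_natr (- 1) n.+1) -(mulr_natr _ (n.+1 * n`!)%N) natrM.
move: (n`!%:R : R) (n.+1%:R : R) => f m f0.
by field.
Qed.

Lemma size_endpoint_kernel n : (size (endpoint_kernel n) <= n.+1)%N.
Proof.
apply: leq_trans (size_scale_leq _ _) _.
have h k p : (size p <= n.+1 + k)%N -> (size p^`(k) <= n.+1)%N.
  elim: k => [|k IH] in p *; first by rewrite addn0.
  move=> pk; rewrite derivSn; apply: IH.
  have [->|p0] := eqVneq p 0; first by rewrite derivC size_poly0.
  by rewrite -ltnS -addnS (leq_trans _ pk)// lt_size_deriv.
apply: h; apply: leq_trans (size_polyMleq _ _) _.
rewrite size_polyXn addSn/= -opprB exprNn -polyC1 -signr_odd.
case: odd; rewrite ?expr1 ?expr0 ?mulN1r ?size_polyN ?mul1r size_exp_XsubC;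
  by rewrite addnS addSn.
Qed.

(** Cauchy-Schwarz against the reproducing kernel [K], whose square integral is
[K(0) = n^2]; concretely, the square of [p - (p(0) / K(0)) K] has a nonnegative
integral. *)
Lemma endpoint_nikolskii01 n p : (size p <= n)%N ->
  p.[0] ^+ 2 <= n%:R ^+ 2 * pint 0 1 (p ^+ 2).
Proof.
case: n => [|n] pn.
  by move: pn; rewrite size_poly_leq0 => /eqP->; rewrite horner0 !expr0n mul0r.
pose K : {poly R} := endpoint_kernel n; pose N : R := n.+1%:R ^+ 2.
have N0 : 0 < N by rewrite exprn_gt0.
suff : 0 <= pint 0 1 ((p - (p.[0] / N) *: K) ^+ 2).
  have -> : (p - (p.[0] / N) *: K) ^+ 2 =
      p ^+ 2 + (- 2 * (p.[0] / N)) *: (p * K) + (p.[0] / N) ^+ 2 *: (K * K).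
    by rewrite -!mul_polyC; ring.
  rewrite !pintD !pintZ !endpoint_kernelP ?size_endpoint_kernel//.
  rewrite endpoint_kernel0 -/N -(pmulr_rge0 _ N0).
  rewrite [X in 0 <= X](_ : _ = N * pint 0 1 (p ^+ 2) - p.[0] ^+ 2); last first.
    by field; rewrite gt_eqF.
  by rewrite subr_ge0.
by apply: pint_ge0 => // t _; rewrite hornerE sqr_ge0.
Qed.

Lemma endpoint_nikolskii n a b p : a <= b -> (size p <= n)%N ->
  p.[a] ^+ 2 * (b - a) <= n%:R ^+ 2 * pint a b (p ^+ 2).
Proof.
move=> ab pn; rewrite -(pint_comp_affine a b).
set l := a%:P + _.
have pl : (size (p \Po l) <= n)%N.
  apply: leq_trans pn; have [->|p0] := eqVneq p 0; first by rewrite comp_poly0.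
  apply: leq_trans (size_comp_poly_leq _ _) _.
  have sl : (size l <= 2)%N.
    apply: leq_trans (size_polyD _ _) _; rewrite geq_max.
    rewrite (leq_trans (size_polyC_leq1 _))//=.
    by rewrite (leq_trans (size_scale_leq _ _))// size_polyX.
  rewrite (leq_trans (n := ((size p).-1 * 1).+1))//.
    by rewrite ltnS leq_mul2l; case: (size l) sl => [|[|[|]]]//; rewrite orbT.
  by rewrite muln1 prednK// lt0n size_poly_eq0.
have := endpoint_nikolskii01 pl.
have l0 : l.[0] = a by rewrite hornerD hornerC hornerZ hornerX mulr0 addr0.
rewrite horner_comp l0 rmorphXn/= => h.
by rewrite mulrCA [leLHS]mulrC ler_wpM2l// subr_ge0.
Qed.

(** The interval [[0, h]] carries at most half of [\int_0^b p^2].  Indeed, for [t]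
in [[0, h]], the endpoint inequality on [[t, b]] bounds [p(t)^2] by
[2 n^2 / b] times that integral, and [h] is [b / (4 n^2)]. *)
Lemma endpoint_nikolskii_gap n b p (h := b / (4 * n%:R ^+ 2)) :
  0 < b -> (0 < n)%N -> (size p <= n)%N ->
  p.[0] ^+ 2 * b <= 2 * n%:R ^+ 2 * pint h b (p ^+ 2).
Proof.
move=> b0 n0 pn; pose N : R := n%:R ^+ 2.
have N1 : 1 <= N by rewrite exprn_ege1// ler1n.
have N0 : 0 < N by lra.
have hE : h * (4 * N) = b by rewrite /h -/N divfK// gt_eqF//; lra.
have h0 : 0 < h by rewrite divr_gt0// mulr_gt0.
have hb : h <= b / 4 by rewrite ler_pdivlMr// -hE; nra.
pose T := pint 0 b (p ^+ 2).
have sq_ge0 a c : a <= c -> 0 <= pint a c (p ^+ 2).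
  by move=> ac; apply: pint_ge0 => // t _; rewrite hornerE sqr_ge0.
have T0 : 0 <= T by apply: sq_ge0; exact: ltW.
have hT : pint 0 h (p ^+ 2) <= T / 2.
  (* The derivative of ['X] stands for the constant 1, whose integral is [h]. *)
  suff : 0 <= pint 0 h ((2 * N * T / b)%:P - p ^+ 2).
    have -> : (2 * N * T / b)%:P - p ^+ 2 =
        (2 * N * T / b) *: ('X)^`() + (-1) *: p ^+ 2.
      by rewrite derivX -!mul_polyC polyCN polyC1; ring.
    rewrite pintD !pintZ pint_deriv !hornerX subr0 mulN1r subr_ge0.
    suff -> : 2 * N * T / b * h = T / 2 by [].
    rewrite -hE; field; rewrite !gt_eqF//; lra.
  apply: pint_ge0 => [|t /andP[t0 th]]; first exact: ltW.
  rewrite hornerD hornerN hornerC horner_exp subr_ge0 ler_pdivlMr//.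
  have tb : t <= b by lra.
  have H1 := endpoint_nikolskii tb pn.
  have H2 : pint t b (p ^+ 2) <= T.
    by rewrite /T -(pint_cat 0 t b) lerDr sq_ge0.
  have H3 : N * pint t b (p ^+ 2) <= N * T by rewrite ler_pM2l.
  have H4 : p.[t] ^+ 2 * b <= p.[t] ^+ 2 * (2 * (b - t)).
    by rewrite ler_wpM2l ?sqr_ge0//; lra.
  by rewrite -/N in H1; lra.
have := endpoint_nikolskii (ltW b0) pn; rewrite subr0 -/N => H.
apply: le_trans H _.
have -> : 2 * N * pint h b (p ^+ 2) = N * (2 * pint h b (p ^+ 2)) by ring.
rewrite ler_pM2l// -/T.
have : T = pint 0 h (p ^+ 2) + pint h b (p ^+ 2) by rewrite pint_cat.
by lra.
Qed.

End PolynomialIntegral.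

(** * Borel sets and uniqueness of Lebesgue measure *)

Section BorelRowVectors.
Context {R : realType}.

Lemma measurable_ball_rV d (c : 'rV[R]_d) (e : R) : 0 < e ->
  measurable (ball c e).
Proof.
move=> e0; rewrite (_ : ball c e =
  [set v | forall i, ball (c ord0 i : R) e (v ord0 i)]).
  apply: (measurable_box (A := fun i => ball (c ord0 i) e)) => i.
  exact: measurable_ball.
apply/seteqP; split => v /= cv; first by move=> i; apply: (proj2 cv).
by split => // i j; rewrite [i]ord1; exact: cv.
Qed.

(** A compact set is the intersection over [k] of finite unions of balls of radius
[1 / (k + 1)] centred in it, and balls of the sup norm are boxes. *)
Lemma compact_measurable_rV d (D : set 'rV[R]_d) : compact D -> measurable D.
Proof.
move=> cD; have := cD; rewrite compact_cover => coverD.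
pose e (k : nat) : R := k.+1%:R^-1.
have e0 k : 0 < e k by rewrite invr_gt0.
have /choice[C CP] k : exists C : {fset 'rV[R]_d},
    {subset C <= D} /\ D `<=` \bigcup_(c in [set` C]) ball c (e k).
  have [||C CD DC] := coverD _ D (fun c => (ball c (e k))°).
  - by move=> c _; exact: open_interior.
  - move=> z Dz; exists z => //; apply: nbhs_singleton.
    by apply: nbhs_interior; exact: nbhsx_ballx.
  - by exists C; split => // z /DC [c Cc /interior_subset]; exists c.
have -> : D = \bigcap_k \bigcup_(c in [set` C k]) ball c (e k).
  apply/seteqP; split => [z Dz k _|z Uz]; first exact: (CP k).2.
  have closedD : closed D by apply: compact_closed => //; exact: norm_hausdorff.
  apply: closedD => A /nbhs_ballP[r /= r0 rA].
  have [k kr] : exists k, e k < r.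
    exists (Num.truncn r^-1); rewrite /e invf_plt ?posrE//.
    exact: truncnS_gt.
  have [c Cc zc] := Uz k I; exists c; split.
    by have := (CP k).1 c Cc; rewrite inE.
  by apply: rA; apply/ball_sym; exact: le_ball (ltW kr) _ zc.
apply: bigcap_measurable => // k _; apply: fin_bigcup_measurable => //.
by move=> c _; exact: measurable_ball_rV.
Qed.

(** Boxes form a family closed under intersection that generates the
sigma-algebra. *)
Lemma lebesgue_rV_unique d (mu : {measure set 'rV[R]_d -> \bar R}) :
  (forall A : 'I_d -> set (measurableTypeR R), (forall i, measurable (A i)) ->
    mu [set v : 'rV[R]_d | forall i, A i (v ord0 i)] =
    (\prod_(i < d) lebesgue_measure (A i))%E) ->
  forall B, measurable B -> lebesgue_rV R d B = mu B.
Proof.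
move=> muE B mB.
pose G : set (set 'rV[R]_d) := [set X |
  exists2 A : 'I_d -> set (measurableTypeR R), forall i, measurable (A i) &
    X = [set v : 'rV[R]_d | forall i, A i (v ord0 i)]].
pose g (k : nat) :=
  [set v : 'rV[R]_d | forall i, `[- k%:R, k%:R]%classic (v ord0 i)].
apply: (measure_unique G g) => //.
- apply/seteqP; split.
    apply: smallest_sub; first exact: smallest_sigma_algebra.
    rewrite -bigcup_seq => X [i _] [A mA <-]; apply: sub_sigma_algebra.
    exists (fun j => if j == i then A else setT).
      by move=> j; case: ifP.
    apply/seteqP; split => v /=; first by move=> [_ Av] j; case: eqVneq => // ->.
    by move=> /(_ i); rewrite eqxx; split.
  apply: smallest_sub; first exact: sigma_algebra_measurable.
  by move=> X [A mA ->]; exact: measurable_box.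
- move=> X Y [A mA ->] [A' mA' ->]; exists (fun i => A i `&` A' i).
    by move=> i; exact: measurableI.
  apply/seteqP; split => v /=; first by move=> [h h'] i.
  by move=> h; split => i; have [] := h i.
- by move=> k; exists (fun=> `[- k%:R, k%:R]%classic).
- apply/seteqP; split => // v _; pose k := Num.truncn (\sum_i `|v ord0 i|).
  exists k.+1 => // i /=; rewrite in_itv/= -ler_norml ltW//.
  apply: le_lt_trans (truncnS_gt _); rewrite (bigD1 i)//= lerDl.
  by apply: sumr_ge0.
- by move=> X [A mA ->]; rewrite (muE A)//; exact: lebesgue_rV_box.
- move=> k; rewrite [X in (X < _)%E](_ : _ =
      (\prod_(i < d) lebesgue_measure `[(- k%:R)%R, k%:R : R]%classic)%E); last first.
    by apply: (@lebesgue_rV_box R d (fun=> `[- k%:R, k%:R]%classic)).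
  suff : (\prod_(i < d) lebesgue_measure `[(- k%:R)%R, k%:R : R]%classic
      \is a fin_num)%E.
    by rewrite fin_numElt => /andP[].
  apply: (big_ind (fun x => x \is a fin_num)%E) => // [|i _].
    exact: fin_numM.
  by rewrite lebesgue_measure_itv/=; case: ifP.
Qed.

End BorelRowVectors.

(** * Affine changes of variables and permutations of coordinates *)

Section ChangeOfVariables.
Context {R : realType}.
Local Open Scope ereal_scope.

(** The measure [c * mu (phi^-1 -)], packaged so that it can be compared with
Lebesgue measure by the uniqueness lemmas. *)
Definition scaled_image d1 d2 (X : measurableType d1) (Y : measurableType d2)
    (mu : {measure set X -> \bar R}) (phi : X -> Y)
    (mphi : measurable_fun setT phi) (c : {nonneg R}) :
    {measure set Y -> \bar R} :=
  mscale c
    (measure_function_pushforward__canonical__measure_function_Measure mu mphi).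

Lemma integral_scaled_pushforward d1 d2 (X : measurableType d1)
    (Y : measurableType d2) (mu : {measure set X -> \bar R})
    (nu : {measure set Y -> \bar R}) (phi : X -> Y) (c : R)
    (F : Y -> \bar R) :
  measurable_fun setT phi -> (0 <= c)%R ->
  (forall B, measurable B -> nu B = c%:E * mu (phi @^-1` B)) ->
  measurable_fun setT F -> (forall y, 0 <= F y) ->
  \int[nu]_y F y = c%:E * \int[mu]_x F (phi x).
Proof.
move=> mphi c0 nuE mF F0.
rewrite (eq_measure_integral (scaled_image mu mphi (NngNum c0))); last first.
  by move=> A mA _; rewrite nuE.
rewrite ge0_integral_mscale//; congr (_ * _).
exact: ge0_integral_pushforward.
Qed.

Lemma lebesgue_measure_affine (a r : R) (B : set (measurableTypeR R)) :
  (r != 0)%R -> measurable B ->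
  lebesgue_measure B =
    `|r|%:E * lebesgue_measure
      ((fun t : measurableTypeR R => (a + r * t)%R : measurableTypeR R) @^-1` B).
Proof.
move=> r0 mB.
pose phi := fun t : measurableTypeR R => (a + r * t)%R : measurableTypeR R.
have mphi : measurable_fun setT phi.
  by apply: measurable_funD => //; exact: measurable_funM.
apply: (lebesgue_measure_unique
  (mu := scaled_image lebesgue_measure mphi
    (@NngNum R `|r|%R (normr_ge0 r)))) => //.
move=> _ [[u v] _ <-]/=.
transitivity (`|r|%:E * lebesgue_measure (phi @^-1` `]u, v]%classic)) => //.
have [r_gt0|r_lt0|] := ltgtP 0%R r; last by move/eqP; rewrite eq_sym (negbTE r0).
- rewrite (_ : phi @^-1` _ = `]((u - a) / r)%R, ((v - a) / r)%R]%classic).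
    rewrite !lebesgue_measure_itv/= !lte_fin ltr_pM2r ?invr_gt0// ltrD2r.
    case: ifP => _; last by rewrite mule0.
    by rewrite gtr0_norm// -EFinM; congr _%:E; field.
  apply/seteqP; split => t; rewrite /phi/= !in_itv/= ltr_pdivrMr// ler_pdivlMr//.
    by move=> /andP[h1 h2]; apply/andP; split; lra.
  by move=> /andP[h1 h2]; apply/andP; split; lra.
- rewrite (_ : phi @^-1` _ = `[((v - a) / r)%R, ((u - a) / r)%R[%classic).
    rewrite !lebesgue_measure_itv/= !lte_fin ltr_nM2r ?invr_lt0// ltrD2r.
    case: ifP => _; last by rewrite mule0.
    by rewrite ltr0_norm// -EFinM; congr _%:E; field.
  apply/seteqP; split => t; rewrite /phi/= !in_itv/= ltr_ndivlMr// ler_ndivrMr//.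
    by move=> /andP[h1 h2]; apply/andP; split; lra.
  by move=> /andP[h1 h2]; apply/andP; split; lra.
Qed.

End ChangeOfVariables.

Section AffineChangeOfVariables.
Context {R : realType}.
Local Open Scope ereal_scope.

Lemma measurable_affine_rV d (a : 'rV[R]_d) (r : R) :
  measurable_fun setT (fun w : 'rV[R]_d => a + r *: w)%R.
Proof.
apply: measurable_fun_rVP => i.
apply: (eq_measurable_fun (fun w : 'rV[R]_d =>
    (a ord0 i + r * w ord0 i)%R : measurableTypeR R)).
  by move=> w _; rewrite !mxE.
by apply: measurable_funD => //; apply: measurable_funM => //; exact: measurable_coord.
Qed.

Lemma integral_affine (a r : R) (F : measurableTypeR R -> \bar R) :
  (r != 0)%R -> measurable_fun setT F -> (forall y, 0 <= F y) ->
  \int[lebesgue_measure]_t F t =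
  `|r|%:E * \int[lebesgue_measure]_t F (a + r * t)%R.
Proof.
move=> r0 mF F0; apply: integral_scaled_pushforward => //.
  by apply: measurable_funD => //; exact: measurable_funM.
by move=> B mB; exact: lebesgue_measure_affine.
Qed.

Lemma integral_affine_rV d (a : 'rV[R]_d) (r : R) (F : 'rV[R]_d -> \bar R) :
  (r != 0)%R -> measurable_fun setT F -> (forall y, 0 <= F y) ->
  \int[lebesgue_rV R d]_w F w =
  (`|r| ^+ d)%:E * \int[lebesgue_rV R d]_w F (a + r *: w)%R.
Proof.
move=> r0 mF F0.
have rd0 : (0 <= `|r| ^+ d)%R by rewrite exprn_ge0.
apply: integral_scaled_pushforward => //; first exact: measurable_affine_rV.
move=> B mB.
apply: (lebesgue_rV_unique
  (mu := scaled_image (lebesgue_rV R d) (measurable_affine_rV a r) (NngNum rd0))) =>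
    // A mA.
transitivity ((`|r| ^+ d)%:E * lebesgue_rV R d [set w : 'rV[R]_d | forall i,
    ((fun t : measurableTypeR R => (a ord0 i + r * t)%R : measurableTypeR R) @^-1` A i)
      (w ord0 i)]).
  congr (_ * _); congr (lebesgue_rV R d _).
  by apply/seteqP; split => w /= h i; have := h i; rewrite !mxE.
rewrite (lebesgue_rV_box (A := fun i => ((fun t : measurableTypeR R =>
  (a ord0 i + r * t)%R : measurableTypeR R) @^-1` A i))); last first.
  move=> i; rewrite -[X in measurable X]setTI.
  have mf : measurable_fun setT (fun t : measurableTypeR R =>
      (a ord0 i + r * t)%R : measurableTypeR R).
    by apply: measurable_funD => //; exact: measurable_funM.
  exact: mf.
rewrite [RHS](eq_bigr _ (fun i _ => lebesgue_measure_affine (a ord0 i) r0 (mA i))).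
rewrite big_split/=; congr (_ * _).
by rewrite prodEFin prodr_const card_ord.
Qed.

Definition permute_rV d (s : 'S_d) (v : 'rV[R]_d) : 'rV[R]_d :=
  \row_i v ord0 (s i).

Lemma measurable_permute_rV d (s : 'S_d) : measurable_fun setT (permute_rV s).
Proof.
apply: measurable_fun_rVP => i.
apply: (eq_measurable_fun (fun w : 'rV[R]_d => w ord0 (s i) : measurableTypeR R)).
  by move=> w _; rewrite !mxE.
exact: measurable_coord.
Qed.

Lemma integral_permute_rV d (s : 'S_d) (F : 'rV[R]_d -> \bar R) :
  measurable_fun setT F -> (forall y, 0 <= F y) ->
  \int[lebesgue_rV R d]_w F w = \int[lebesgue_rV R d]_w F (permute_rV s w).
Proof.
move=> mF F0; rewrite -[RHS]mul1e.
apply: integral_scaled_pushforward => //; first exact: measurable_permute_rV.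
move=> B mB.
apply: (lebesgue_rV_unique
  (mu := scaled_image (lebesgue_rV R d) (measurable_permute_rV s)
    (NngNum ler01))) => // A mA.
transitivity (1%:E * lebesgue_rV R d [set w : 'rV[R]_d | forall i,
    A ((s^-1)%g i) (w ord0 i)]).
  congr (_ * _); congr (lebesgue_rV R d _).
  apply/seteqP; split => w /= h i.
    by have := h ((s^-1)%g i); rewrite mxE permKV.
  by have := h (s i); rewrite mxE permK.
rewrite mul1e (lebesgue_rV_box (A := fun i => A ((s^-1)%g i)))//.
by rewrite [RHS](reindex_inj (@perm_inj _ (s^-1)%g)).
Qed.

End AffineChangeOfVariables.

(** * Parametrizing the hyperplane orthogonal to a unit vector *)

Section Hyperplane.
Context {R : realType} {k : nat}.
Implicit Types (u x z : 'rV[R]_k.+1) (w : 'rV[R]_k).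

(** With [lift_perp], this solves the equation [dotv u z = 0] for the first
coordinate of [z] in terms of the others, assuming that [u ord0 ord0] is not
zero. *)
Definition slope u w : R :=
  (\sum_(j < k) u ord0 (lift ord0 j) * w ord0 j) / u ord0 ord0.

Definition lift_perp u w : 'rV[R]_k.+1 := consv (- slope u w, w).

Definition tail_rV z : 'rV[R]_k := \row_j z ord0 (lift ord0 j).

Lemma dotv_recl u z : dotv u z =
  u ord0 ord0 * z ord0 ord0 + dotv (tail_rV u) (tail_rV z).
Proof.
rewrite /dotv big_ord_recl; congr (_ + _).
by apply: eq_bigr => i _; rewrite !mxE.
Qed.

Lemma tail_lift_perp u w : tail_rV (lift_perp u w) = w.
Proof. by apply/rowP => j; rewrite mxE consvS. Qed.

Lemma slopeE u w : slope u w = dotv (tail_rV u) w / u ord0 ord0.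
Proof. by congr (_ / _); apply: eq_bigr => j _; rewrite mxE. Qed.

Lemma slopeD u w1 w2 : slope u (w1 + w2) = slope u w1 + slope u w2.
Proof.
rewrite /slope -mulrDl -big_split/=; congr (_ / _).
by apply: eq_bigr => j _; rewrite mxE mulrDr.
Qed.

Lemma slopeZ u c w : slope u (c *: w) = c * slope u w.
Proof.
rewrite /slope mulrA mulr_sumr; congr (_ / _).
by apply: eq_bigr => j _; rewrite mxE mulrCA.
Qed.

Lemma dotv_lift_perp u w : u ord0 ord0 != 0 -> dotv u (lift_perp u w) = 0.
Proof.
move=> u0; rewrite dotv_recl tail_lift_perp consv0/= slopeE.
by rewrite mulrN mulrC divfK// addNr.
Qed.

Lemma lift_perpZ u c w : lift_perp u (c *: w) = c *: lift_perp u w.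
Proof.
apply/rowP => i; have [j ->|->] := unliftP ord0 i; rewrite [RHS]mxE.
  by rewrite /lift_perp !consvS mxE.
by rewrite /lift_perp !consv0/= slopeZ mulrN.
Qed.

Lemma measurable_slope u :
  measurable_fun setT (fun w => slope u w : measurableTypeR R).
Proof.
apply: measurable_funM => //.
apply: measurable_sum => j; apply: measurable_funM => //.
exact: measurable_coord.
Qed.

Lemma measurable_lift_perp u : measurable_fun setT (lift_perp u).
Proof.
apply: (measurableT_comp measurable_consv).
apply: measurable_fun_pair => //=.
by apply: measurable_funN; exact: measurable_slope.
Qed.

Local Open Scope ereal_scope.

Lemma integral_cons (F : 'rV[R]_k.+1 -> \bar R) :
  measurable_fun setT F -> (forall z, 0 <= F z) ->
  \int[lebesgue_rV R k.+1]_z F z =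
  \int[lebesgue_rV R k]_w \int[lebesgue_measure]_t F (consv (t, w)).
Proof.
move=> mF F0.
transitivity (\int[@lebesgue_measure R \x lebesgue_rV R k]_p F (consv p)).
  rewrite [LHS](ge0_integral_pushforward measurable_consv
    (@lebesgue_measure R \x lebesgue_rV R k))//.
rewrite (fubini_tonelli2 (fun p => F (consv p)))//.
by apply: measurableT_comp => //; exact: measurable_consv.
Qed.

(** The map [(t, w) |-> x + t u + lift_perp u w] splits into two affine maps.  For a
fixed tail [z] the first coordinate is affine in [t] with slope [1 / u_0], by
[|u| = 1]; for fixed [t] the tail is a translate of [w].  Each is an affine
change of variables in one factor of the product measure. *)
Lemma integral_lift_perp (x u : 'rV[R]_k.+1) (F : 'rV[R]_k.+1 -> \bar R) :
  (dotv u u = 1)%R -> u ord0 ord0 != 0%R ->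
  measurable_fun setT F -> (forall z, 0 <= F z) ->
  \int[lebesgue_rV R k.+1]_z F z =
  `|(u ord0 ord0)^-1|%:E * \int[lebesgue_measure]_t
    \int[lebesgue_rV R k]_w F (x + t *: u + lift_perp u w)%R.
Proof.
move=> uu u0 mF F0.
(* [g (t, z)] is the point on the hyperplane of height [t] with tail [z]. *)
pose c (w : 'rV[R]_k) : R := (x ord0 ord0 - slope u (w - tail_rV x))%R.
pose g (p : measurableTypeR R * 'rV[R]_k) : 'rV[R]_k.+1 :=
  consv ((c p.2 + (u ord0 ord0)^-1 * p.1)%R, p.2).
have mc : measurable_fun setT (fun w => c w : measurableTypeR R).
  apply: measurable_funB => //.
  apply: (eq_measurable_fun
      (fun w => slope u (- tail_rV x + 1 *: w)%R : measurableTypeR R)).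
    by move=> w _; rewrite scale1r addrC.
  exact: (measurableT_comp (measurable_slope u) (measurable_affine_rV _ _)).
have mg : measurable_fun setT g.
  apply: (measurableT_comp measurable_consv).
  apply: measurable_fun_pair => //=.
  apply: measurable_funD; last by apply: measurable_funM.
  exact: (measurableT_comp mc).
have mFg : measurable_fun setT (fun p => F (g p)) by exact: measurableT_comp.
rewrite integral_cons//.
transitivity (\int[lebesgue_rV R k]_w
    (`|(u ord0 ord0)^-1|%:E * \int[lebesgue_measure]_t F (g (t, w)))).
  apply: eq_integral => w _.
  rewrite (integral_affine (F := fun t => F (consv (t, w))) (c w) (invr_neq0 u0))//.
  apply: measurableT_comp => //; apply: (measurableT_comp measurable_consv).
  exact: measurable_fun_pair.
rewrite ge0_integralZl//; last 2 first.
- exact: (@measurable_fun_fubini_tonelli_G _ _ _ _ _ lebesgue_measure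
    (fun p => F (g p))).
- by move=> w _; apply: integral_ge0.
congr (_ * _).
rewrite -(fubini_tonelli (fun p => F (g p)))//.
apply: eq_integral => t _.
rewrite (integral_affine_rV (F := fun w => F (g (t, w)))
  (tail_rV x + t *: tail_rV u) (oner_neq0 _))//; last first.
  by apply: (measurableT_comp mFg); exact: measurable_fun_pair.
rewrite normr1 expr1n mul1e; apply: eq_integral => w _; congr F.
rewrite scale1r.
have uu0 : ((u ord0 ord0)^-1 = u ord0 ord0 + slope u (tail_rV u))%R.
  apply: (mulIf u0); rewrite mulVf// -uu dotv_recl mulrDl; congr (_ + _)%R.
  by rewrite slopeE divfK.
apply/rowP => i.
rewrite [RHS]mxE [X in (_ = X + _)%R]mxE [X in (_ = _ + X + _)%R]mxE.
have [j ->|->] := unliftP ord0 i.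
  by rewrite /lift_perp !consvS/= !mxE.
rewrite /lift_perp !consv0/= /c.
rewrite (_ : _ + _ + w - _ = t *: tail_rV u + w)%R; last first.
  by apply/rowP => j; rewrite !mxE; ring.
by rewrite slopeD slopeZ uu0; ring.
Qed.

End Hyperplane.

Section PivotedHyperplane.
Context {R : realType} {k : nat}.
Implicit Types (u x z : 'rV[R]_k.+1) (w : 'rV[R]_k).

Lemma dotv_permute (s : 'S_k.+1) u z :
  dotv (permute_rV s u) (permute_rV s z) = dotv u z.
Proof.
rewrite /dotv [RHS](reindex_inj (@perm_inj _ s)).
by apply: eq_bigr => i _; rewrite !mxE.
Qed.

Lemma dotv_ge0 d (v : 'rV[R]_d) : 0 <= dotv v v.
Proof. by apply: sumr_ge0 => i _; rewrite -expr2 sqr_ge0. Qed.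

Lemma dotv_eq0 d (v : 'rV[R]_d) : dotv v v = 0 -> v = 0.
Proof.
move=> /eqP; rewrite psumr_eq0 => [/allP h|i _]; last by rewrite -expr2 sqr_ge0.
apply/rowP => i; rewrite mxE; apply/eqP.
by have := h i; rewrite mem_index_enum -expr2 sqrf_eq0 => /(_ isT).
Qed.

Lemma dotvZr d (v z : 'rV[R]_d) c : dotv v (c *: z) = c * dotv v z.
Proof. by rewrite mulr_sumr; apply: eq_bigr => i _; rewrite mxE mulrCA. Qed.

Lemma dotvZl d (v z : 'rV[R]_d) c : dotv (c *: v) z = c * dotv v z.
Proof. by rewrite mulr_sumr; apply: eq_bigr => i _; rewrite mxE mulrA. Qed.

Lemma unit_coord_le1 u i : dotv u u = 1 -> `|u ord0 i| <= 1.
Proof.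
move=> uu; rewrite -(@ler_sqr _ `|_|) ?nnegrE// expr1n real_normK ?num_real//.
rewrite -uu /dotv (bigD1 i)//= -expr2 lerDl.
by apply: sumr_ge0 => j _; rewrite -expr2 sqr_ge0.
Qed.

(** Otherwise the squares of the coordinates would sum to less than 1.  Pivoting on
such a coordinate keeps the parametrization of the hyperplane bounded
independently of [u]. *)
Lemma unit_large_coord u : dotv u u = 1 ->
  exists i, 1 <= k.+1%:R * `|u ord0 i|.
Proof.
move=> uu; apply: contrapT => /forallNP small.
suff : dotv u u < 1 by rewrite uu ltxx.
have -> : 1 = \sum_(i < k.+1) (k.+1%:R^-1 : R).
  by rewrite sumr_const card_ord -[RHS]mulr_natr mulVf// pnatr_eq0.
apply: ltr_sum; first by apply/hasP; exists ord0; rewrite ?mem_index_enum.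
move=> i _; have /negP := small i; rewrite -ltNge => ui.
have ui1 := unit_coord_le1 i uu.
have k0 : 0 < k.+1%:R :> R by rewrite ltr0n.
rewrite -expr2 -(ger0_norm (sqr_ge0 _)) normrX expr2.
apply: le_lt_trans (_ : 1 * `|u ord0 i| < _); first by rewrite ler_wpM2r.
by rewrite mul1r -div1r ltr_pdivlMr// mulrC.
Qed.

Lemma dotv_lift_perp_le u w : dotv u u = 1 -> 1 <= k.+1%:R * `|u ord0 ord0| ->
  (forall j, 0 <= w ord0 j <= 1) ->
  dotv (lift_perp u w) (lift_perp u w) <= k.+1%:R ^+ 4.
Proof.
move=> uu u0 w01; rewrite dotv_recl tail_lift_perp /lift_perp consv0/= mulrNN.
have u00 : 0 < `|u ord0 ord0|.
  rewrite lt_neqAle normr_ge0 andbT; apply: contraTneq u0 => <-.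
  by rewrite mulr0 ler10.
have ww : dotv w w <= k%:R.
  rewrite -[k in leRHS]card_ord -sumr_const; apply: ler_sum => j _.
  by have /andP[? ?] := w01 j; rewrite -[leRHS]mulr1 ler_pM.
have sl : `|slope u w| <= k%:R * k.+1%:R.
  rewrite /slope normrM normfV ler_pdivrMr// -mulrA.
  apply: (@le_trans _ _ (k%:R)); last by rewrite ler_peMr.
  apply: le_trans (ler_norm_sum _ _ _) _.
  rewrite -[k in leRHS]card_ord -sumr_const; apply: ler_sum => j _.
  have /andP[? ?] := w01 j; rewrite normrM -[leRHS]mulr1 ler_pM//.
    exact: unit_coord_le1.
  by rewrite ger0_norm.
have : `|slope u w| ^+ 2 <= (k%:R * k.+1%:R) ^+ 2.
  by rewrite ler_sqr// nnegrE.
rewrite real_normK ?num_real// expr2 => h.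
have -> : k.+1%:R = k%:R + 1 :> R by rewrite -natr1.
rewrite -natr1 in h; have := ler0n R k; move: (k%:R : R) h ww => m; nra.
Qed.

(** [lift_perp] with the roles of the coordinates [0] and [i] exchanged, so that the
pivot is [u ord0 i]. *)
Definition embed_perp i u w : 'rV[R]_k.+1 :=
  permute_rV (tperm ord0 i) (lift_perp (permute_rV (tperm ord0 i) u) w).

Lemma permute_tpermK i : involutive (@permute_rV R k.+1 (tperm ord0 i)).
Proof. by move=> z; apply/rowP => j; rewrite !mxE tpermK. Qed.

Lemma permute_pivot i u : permute_rV (tperm ord0 i) u ord0 ord0 = u ord0 i.
Proof. by rewrite mxE tpermL. Qed.

Lemma embed_perpZ i u c w : embed_perp i u (c *: w) = c *: embed_perp i u w.
Proof. by rewrite /embed_perp lift_perpZ; apply/rowP => j; rewrite !mxE. Qed.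

Lemma dotv_embed_perp i u w : u ord0 i != 0 -> dotv u (embed_perp i u w) = 0.
Proof.
move=> ui; rewrite -{1}(permute_tpermK i u) dotv_permute dotv_lift_perp//.
by rewrite permute_pivot.
Qed.

Lemma embed_perp_eq0 i u w : embed_perp i u w = 0 -> w = 0.
Proof.
move=> /(congr1 (permute_rV (tperm ord0 i))); rewrite permute_tpermK => h.
rewrite -(tail_lift_perp (permute_rV (tperm ord0 i) u) w) h.
by apply/rowP => j; rewrite !mxE.
Qed.

Lemma measurable_embed_perp i u : measurable_fun setT (embed_perp i u).
Proof.
apply: (measurableT_comp (measurable_permute_rV _)).
exact: measurable_lift_perp.
Qed.

(** Uniform in [u], which is why the final constant depends only on the dimension
and the parameters of the horn. *)
Lemma dotv_embed_perp_le i u w : dotv u u = 1 -> 1 <= k.+1%:R * `|u ord0 i| ->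
  (forall j, 0 <= w ord0 j <= 1) ->
  dotv (embed_perp i u w) (embed_perp i u w) <= k.+1%:R ^+ 4.
Proof.
move=> uu ui w01; rewrite dotv_permute dotv_lift_perp_le//.
  by rewrite dotv_permute.
by rewrite permute_pivot.
Qed.

Local Open Scope ereal_scope.

(** The exact Jacobian is [1 / |u_i|], which is at least 1. *)
Lemma le_integral_embed_perp i (x u : 'rV[R]_k.+1) (F : 'rV[R]_k.+1 -> \bar R) :
  dotv u u = 1%R -> u ord0 i != 0%R ->
  measurable_fun setT F -> (forall z, 0 <= F z) ->
  \int[lebesgue_measure]_t \int[lebesgue_rV R k]_w F (x + t *: u + embed_perp i u w)%R
  <= \int[lebesgue_rV R k.+1]_z F z.
Proof.
move=> uu ui mF F0; pose s := tperm ord0 i.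
rewrite (integral_permute_rV s)//.
rewrite (integral_lift_perp (permute_rV s x) (u := permute_rV s u))//; last 3 first.
- by rewrite dotv_permute.
- by rewrite permute_pivot.
- by apply: measurableT_comp => //; exact: measurable_permute_rV.
rewrite permute_pivot -[leLHS]mul1e lee_pmul//.
- by apply: integral_ge0 => t _; apply: integral_ge0.
- by rewrite lee_fin normfV invf_ge1 ?normr_gt0// unit_coord_le1.
rewrite le_eqVlt; apply/orP; left; apply/eqP.
apply: eq_integral => t _; apply: eq_integral => w _; congr F.
by apply/rowP => j; rewrite !mxE !tpermK.
Qed.

End PivotedHyperplane.

(** * Polynomials along parabolas *)

Section PolynomialsOnCurves.
Context {R : realType} {d : nat}.
Implicit Types (p : mpoly d R) (x u v : 'rV[R]_d).

Lemma measurable_evalp p :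
  measurable_fun setT (fun y : 'rV[R]_d => evalp p y : measurableTypeR R).
Proof.
rewrite /evalp; under eq_fun do rewrite mevalE.
apply: measurable_sum => m; apply: measurable_funM => //.
apply: measurable_prod => i _; apply: measurable_funX; exact: measurable_coord.
Qed.

Definition parabola_poly p x u v : {poly R} :=
  mmap (@polyC R) (fun i => (x ord0 i)%:P + u ord0 i *: 'X^2 + v ord0 i *: 'X) p.

Lemma horner_parabola_poly p x u v t :
  (parabola_poly p x u v).[t] = evalp p (x + t ^+ 2 *: u + t *: v).
Proof.
rewrite /evalp mevalE /parabola_poly /mmap horner_sum; apply: eq_bigr => m _.
rewrite hornerM hornerC /mmap1 horner_prod; congr (_ * _).
apply: eq_bigr => i _; rewrite horner_exp !hornerD !hornerZ hornerXn hornerX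
  hornerC !mxE.
by rewrite (mulrC t) (mulrC (t ^+ 2)).
Qed.

Lemma size_parabola_poly n p x u v : polys n p ->
  (size (parabola_poly p x u v) <= n.*2.+1)%N.
Proof.
move=> pn; apply: leq_trans (size_sum _ _ _) _.
rewrite big_seq; apply: (big_ind (fun j => j <= n.*2.+1)%N) => //.
  by move=> i j ij1 ij2; rewrite geq_max ij1.
move=> m mp; rewrite mul_polyC; apply: leq_trans (size_scale_leq _ _) _.
have mn : (mdeg m <= n)%N.
  by rewrite -ltnS; apply: leq_trans pn; exact: mmeasure_mnm_lt.
pose h i : {poly R} := (x ord0 i)%:P + u ord0 i *: 'X^2 + v ord0 i *: 'X.
suff : (size (mmap1 h m) <= (mdeg m).*2.+1)%N.
  by move=> /leq_trans; apply; rewrite ltnS leq_double.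
rewrite mdegE -mul2n big_distrr/=.
apply: (big_ind2 (fun (q : {poly R}) j => (size q <= j.+1)%N)).
- by rewrite size_poly1.
- move=> q1 j1 q2 j2 h1 h2; apply: leq_trans (size_polyMleq _ _) _.
  rewrite -subn1 leq_subLR add1n -addnS -addSn.
  exact: leq_add.
move=> i _; apply: leq_trans (size_poly_exp_leq _ _) _.
rewrite ltnS leq_mul2r; apply/orP; right.
set q := (X in size X).
suff : (size q <= 3)%N by case: (size q).
apply: leq_trans (size_polyD _ _) _; rewrite geq_max; apply/andP; split.
  apply: leq_trans (size_polyD _ _) _; rewrite geq_max; apply/andP; split.
    by apply: leq_trans (size_polyC_leq1 _) _.
  by apply: leq_trans (size_scale_leq _ _) _; rewrite size_polyXn.
by apply: leq_trans (size_scale_leq _ _) _; rewrite size_polyX.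
Qed.

(** Averaging over the two branches of a parabola keeps the even powers of [t], so
the degree in [t^2] is at most [n] rather than [2 n]. *)
Lemma parabola_even_part n p x u v : polys n p ->
  exists A : {poly R}, [/\ (size A <= n.+1)%N, A.[0] = evalp p x &
    forall t, evalp p (x + t ^+ 2 *: u + t *: v) +
      evalp p (x + t ^+ 2 *: u - t *: v) = 2 * A.[t ^+ 2]].
Proof.
move=> pn; pose q := parabola_poly p x u v.
have qE t : q.[t] = (even_poly q).[t ^+ 2] + (odd_poly q).[t ^+ 2] * t.
  by rewrite -{1}(poly_even_odd q) hornerD hornerM !horner_comp hornerXn hornerX.
exists (even_poly q); split.
- apply: leq_trans (size_even_poly _) _; rewrite leq_uphalf_double doubleS.
  exact: leq_trans (size_parabola_poly x u v pn) (leqnSn _).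
- have := qE 0; rewrite mulr0 addr0 expr0n/= => <-.
  by rewrite horner_parabola_poly expr0n/= !scale0r !addr0.
- move=> t; have := qE (- t); have := qE t; rewrite !horner_parabola_poly sqrrN.
  by rewrite scaleNr => -> ->; ring.
Qed.

End PolynomialsOnCurves.

(** * The extremal polynomial *)

Section ExtremalPolynomial.
Context {R : realType} {d : nat}.

Lemma evalp_lincomb N (phi : 'I_N -> mpoly d R) (a : 'I_N -> R) y :
  evalp (\sum_(k < N) a k *: phi k) y = \sum_(k < N) a k * evalp (phi k) y.
Proof.
rewrite /evalp raddf_sum; apply: eq_bigr => k _.
exact: mevalZ.
Qed.

Lemma polys_lincomb n N (phi : 'I_N -> mpoly d R) (a : 'I_N -> R) :
  (forall k, polys n (phi k)) -> polys n (\sum_(k < N) a k *: phi k).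
Proof.
move=> phin; apply: leq_trans (mmeasure_sum _ _ _ _) _.
apply: (big_ind (fun j => j <= n.+1)%N) => //.
  by move=> i j ij1 ij2; rewrite geq_max ij1.
by move=> k _; apply: leq_trans (mmeasureZ_le _ _ _) (phin k).
Qed.

(** A real-valued integral sends [+oo] to 0, so the value 1 of [\int_D phi_i^2]
shows that it is finite; the products are dominated by the sums of squares. *)
Lemma integrable_evalpM (D : set 'rV[R]_d) N (phi : 'I_N -> mpoly d R) j k :
  measurable D -> orthonormal_in_L2 D phi ->
  (lebesgue_rV R d).-integrable D
    (fun y => (evalp (phi j) y * evalp (phi k) y)%:E).
Proof.
move=> mD ortho.
have mphi i1 i2 : measurable_fun D
    (fun y => (evalp (phi i1) y * evalp (phi i2) y)%:E).
  apply/measurable_EFinP; apply: measurable_funS (@subsetT _ D) _ => //.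
  by apply: measurable_funM; exact: measurable_evalp.
have isq i : (lebesgue_rV R d).-integrable D
    (fun y => (evalp (phi i) y * evalp (phi i) y)%:E).
  apply/integrableP; split => //.
  rewrite (eq_integral
    (fun y => (evalp (phi i) y * evalp (phi i) y)%:E)); last first.
    by move=> y _; rewrite gee0_abs// lee_fin -expr2 sqr_ge0.
  have := ortho i i; rewrite eqxx /dotL2 /Rintegral.
  case: (integral _ _ _) => [r _| |] /=; first exact: ltry.
    by move/eqP; rewrite eq_sym oner_eq0.
  by move/eqP; rewrite eq_sym oner_eq0.
apply: le_integrable (integrableD mD (isq j) (isq k)) => // y _.
rewrite lee_fin [leRHS]ger0_norm; last by rewrite addr_ge0// -expr2 sqr_ge0.
by rewrite ler_norml; apply/andP; split; nra.
Qed.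

(** The polynomial is the kernel [\sum_k phi_k(x) phi_k], and its square integral is
computed by orthonormality. *)
Lemma christoffel_extremal n (D : set 'rV[R]_d) x y :
  measurable D -> is_christoffel n D x y ->
  exists p, [/\ polys n p, evalp p x = y &
    (\int[lebesgue_rV R d]_(z in D) (evalp p z ^+ 2)%:E = y%:E)%E].
Proof.
move=> mD [N [phi [[phin _] ortho ->]]].
exists (\sum_(k < N) evalp (phi k) x *: phi k); split.
- exact: polys_lincomb.
- by rewrite evalp_lincomb; apply: eq_bigr => k _; rewrite expr2.
pose a k : R := evalp (phi k) x.
have int_sum := integrable_evalpM _ _ mD ortho.
transitivity (\int[lebesgue_rV R d]_(z in D) \sum_(j < N) \sum_(k < N)
    ((a j * a k)%:E * (evalp (phi j) z * evalp (phi k) z)%:E))%E.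
  apply: eq_integral => z _; rewrite evalp_lincomb expr2 mulr_suml -sumEFin.
  apply: eq_bigr => j _; rewrite mulr_sumr -sumEFin; apply: eq_bigr => k _.
  by rewrite -EFinM; congr _%:E; rewrite /a; ring.
have intZ j k : (lebesgue_rV R d).-integrable D
    (fun z => ((a j * a k)%:E * (evalp (phi j) z * evalp (phi k) z)%:E)%E).
  exact: integrableZl.
rewrite integral_sum//; last by move=> j; exact: integrable_sum.
rewrite -sumEFin; apply: eq_bigr => j _.
rewrite integral_sum//.
rewrite (bigD1 j)//= big1 ?adde0 => [|k kj].
all: rewrite integralZl// -[X in (_ * X)%E]fineK ?integrable_fin_num//.
all: rewrite -[fine _]/(dotL2 D (phi _) (phi _)) ortho.
  by rewrite eqxx mule1 -expr2.
by rewrite eq_sym (negbTE kj) mule0.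
Qed.

End ExtremalPolynomial.

(** * The estimate on a truncated paraboloid *)

Section ParaboloidEstimate.
Context {R : realType} {k : nat}.

Definition unit_cube : set 'rV[R]_k := [set w | forall j, 0 <= w ord0 j <= 1].

Lemma measurable_unit_cube : measurable unit_cube.
Proof.
rewrite (_ : unit_cube = [set w : 'rV[R]_k | forall j : 'I_k,
    `[0 : R, 1]%classic (w ord0 j)]).
  by apply: (measurable_box (A := fun=> `[0, 1]%classic)) => j; exact: measurable_itv.
by apply/seteqP; split => w /= h j; have := h j; rewrite in_itv.
Qed.

Lemma lebesgue_unit_cube :
  lebesgue_rV R k unit_cube = 1%E.
Proof.
rewrite (_ : unit_cube = [set w : 'rV[R]_k | forall j : 'I_k,
    `[0 : R, 1]%classic (w ord0 j)]); last first.
  by apply/seteqP; split => w /= h j; have := h j; rewrite in_itv.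
rewrite (lebesgue_rV_box (A := fun=> `[0, 1]%classic)); last first.
  by move=> j; exact: measurable_itv.
by rewrite big1// => j _; rewrite lebesgue_measure_itv/= lte_fin ltr01 sube0.
Qed.

(** On each slice [t] the two homotheties [w |-> +/- a sqrt(t) w] have Jacobian at
least [(a sqrt(h))^k]; summing their contributions and exchanging the order of
integration leaves, for each [w], a univariate problem solved by
[endpoint_nikolskii_gap] applied to the even part of [p] along a parabola. *)
Lemma integral_paraboloid_ge n (D : set 'rV[R]_k.+1) (x u : 'rV[R]_k.+1) i
    (a b : R) (p : mpoly k.+1 R) (h := b / (4 * n.+1%:R ^+ 2)) :
  dotv u u = 1 -> u ord0 i != 0 -> measurable D -> polys n p ->
  0 < a -> 0 < b ->
  (forall t r (w : 'rV[R]_k), h <= t <= b -> `|r| = a * Num.sqrt t ->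
    unit_cube w -> D (x + t *: u + r *: embed_perp i u w)) ->
  (((a * Num.sqrt h) ^+ k * (evalp p x ^+ 2 * b))%:E <=
   (2 * n.+1%:R ^+ 2)%:E *
     \int[lebesgue_rV R k.+1]_(z in D) (evalp p z ^+ 2)%:E)%E.
Proof.
move=> uu ui mD pn a0 b0 subD.
pose N : R := n.+1%:R ^+ 2; pose J : R := (a * Num.sqrt h) ^+ k.
have N0 : 0 < N by rewrite exprn_gt0.
have h0 : 0 < h by rewrite divr_gt0// mulr_gt0.
have hb : h < b.
  rewrite ltr_pdivrMr ?mulr_gt0// -[ltLHS]mulr1 ltr_pM2l//.
  have : 1 <= N by rewrite exprn_ege1// ler1n.
  by rewrite -/N; lra.
have J0 : 0 <= J by rewrite exprn_ge0// mulr_ge0 ?sqrtr_ge0// ltW.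
pose Q := unit_cube.
have mQ : measurable Q := measurable_unit_cube.
pose I := `[h, b]%classic : set (measurableTypeR R).
have mI : measurable I by exact: measurable_itv.
pose F := (fun z => (evalp p z ^+ 2)%:E) \_ D.
have F0 z : (0 <= F z)%E.
  by rewrite /F /patch; case: ifP => //; rewrite lee_fin sqr_ge0.
have mF : measurable_fun setT F.
  apply/(measurable_restrictT _ mD)/measurable_EFinP.
  apply: measurable_funS (@subsetT _ D) _ => //.
  by apply: measurable_funX; exact: measurable_evalp.
pose arc (r : measurableTypeR R -> R) (q : measurableTypeR R * 'rV[R]_k) :
    'rV[R]_k.+1 :=
  x + q.1 *: u + r q.1 *: embed_perp i u q.2.
have marc r : measurable_fun setT (r : measurableTypeR R -> measurableTypeR R) ->
    measurable_fun setT (arc r).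
  move=> mr; apply: measurable_fun_rVP => j.
  apply: (eq_measurable_fun (fun q : measurableTypeR R * 'rV[R]_k =>
      (x ord0 j + q.1 * u ord0 j + r q.1 * embed_perp i u q.2 ord0 j)%R
        : measurableTypeR R)).
    by move=> q _; rewrite [RHS]mxE [X in _ = X + _]mxE
      [X in _ = _ + X + _]mxE [X in _ = _ + X]mxE.
  apply: measurable_funD.
    by apply: measurable_funD => //; exact: measurable_funM.
  apply: measurable_funM; first exact: (measurableT_comp mr).
  apply: (measurableT_comp (measurable_coord j)).
  exact: (measurableT_comp (measurable_embed_perp i u)).
pose G r q : R := evalp p (arc r q) ^+ 2.
have mG r : measurable_fun setT (r : measurableTypeR R -> measurableTypeR R) ->
    measurable_fun setT (fun q => G r q : measurableTypeR R).
  move=> mr; apply: measurable_funX.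
  exact: (measurableT_comp (measurable_evalp p) (marc r mr)).
pose r1 : measurableTypeR R -> R := fun=> 1.
pose rp : measurableTypeR R -> R := fun t => a * Num.sqrt t.
pose rm : measurableTypeR R -> R := fun t => - (a * Num.sqrt t).
have mrp : measurable_fun setT (rp : measurableTypeR R -> measurableTypeR R).
  apply: measurable_funM => //; apply: continuous_measurable_fun.
  exact: sqrt_continuous.
have mrm : measurable_fun setT (rm : measurableTypeR R -> measurableTypeR R).
  by apply: measurable_funN.
pose K := (fun q => (G rp q + G rm q)%:E) \_ (I `*` Q).
have mK : measurable_fun setT K.
  apply/(measurable_restrictT _ (measurableX mI mQ))/measurable_EFinP.
  apply: measurable_funS (@subsetT _ _) _ => //.
  by apply: measurable_funD; exact: mG.
have K0 q : (0 <= K q)%E.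
  by rewrite /K /patch; case: ifP => //; rewrite lee_fin addr_ge0 ?sqr_ge0.
have mpair1 t : measurable_fun setT
    (fun w : 'rV[R]_k => (t : measurableTypeR R, w)).
  exact: measurable_fun_pair.
have mpair2 w : measurable_fun setT
    (fun t : measurableTypeR R => (t, w : 'rV[R]_k)).
  exact: measurable_fun_pair.
pose H (t : measurableTypeR R) : \bar R :=
  (\int[lebesgue_rV R k]_w F (arc r1 (t, w)))%E.
have mFarc : measurable_fun setT (fun q => F (arc r1 q)).
  by apply: measurableT_comp => //; apply: marc; exact: measurable_cst.
have H0 t : (0 <= H t)%E by exact: integral_ge0.
have mH : measurable_fun setT H.
  exact: (@measurable_fun_fubini_tonelli_F _ _ _ _ _ (lebesgue_rV R k)
    (fun q => F (arc r1 q))).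
(* Undoing the homothety of ratio [r t] costs the Jacobian [|r t|^k], which is
   at least [J] as [t >= h]; the image of the cube lies in [D], where [F] is
   [p^2]. *)
have half (r : measurableTypeR R -> R) t :
    measurable_fun setT (r : measurableTypeR R -> measurableTypeR R) ->
    h <= t <= b -> `|r t| = a * Num.sqrt t ->
    (J%:E * \int[lebesgue_rV R k]_(w in Q) (G r (t, w))%:E <= H t)%E.
  move=> mr tI rt.
  have t0 : 0 < t by have /andP[ht _] := tI; exact: lt_le_trans ht.
  have rt0 : r t != 0 by rewrite -normr_gt0 rt mulr_gt0// sqrtr_gt0.
  have mFt : measurable_fun setT (fun w => F (arc r (t, w))).
    exact: (measurableT_comp mF (measurableT_comp (marc r mr) (mpair1 t))).
  have arcE w : arc r1 (t, 0 + r t *: w) = arc r (t, w).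
    by rewrite /arc /r1 add0r embed_perpZ scale1r.
  have mFt1 : measurable_fun setT (fun w => F (arc r1 (t, w))).
    exact: (measurableT_comp mFarc (mpair1 t)).
  have -> : H t =
      ((`|r t| ^+ k)%:E * \int[lebesgue_rV R k]_w F (arc r (t, w)))%E.
    have := integral_affine_rV 0 rt0 mFt1 (fun w => F0 _).
    by under [in X in _ = X -> _]eq_integral do rewrite arcE.
  apply: lee_pmul.
  - by rewrite lee_fin.
  - by apply: integral_ge0 => w _; rewrite lee_fin sqr_ge0.
  - rewrite lee_fin rt /J; apply: lerXn2r;
      rewrite ?nnegrE ?mulr_ge0 ?sqrtr_ge0 ?(ltW a0)//.
    by rewrite ler_pM2l// ler_sqrt ?(ltW t0)//; have /andP[] := tI.
  - rewrite (eq_integral (fun w => F (arc r (t, w)))); last first.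
      move=> w; rewrite inE => wQ; rewrite /F /patch mem_set//.
      exact: subD.
    exact: (ge0_subset_integral _ mQ measurableT mFt (fun w _ => F0 _)
      (@subsetT _ Q)).
have slice t : (J%:E * \int[lebesgue_rV R k]_w K (t, w) <= 2%:E * H t)%E.
  have [tI|tI] := boolP (h <= t <= b); last first.
    rewrite integral0_eq ?mule0 ?mule_ge0// => w _.
    rewrite /K /patch; case: ifPn => //; rewrite inE => -[].
    by rewrite /I/= in_itv/= (negbTE tI).
  have -> : (\int[lebesgue_rV R k]_w K (t, w) =
     \int[lebesgue_rV R k]_(w in Q) ((G rp (t, w))%:E + (G rm (t, w))%:E))%E.
    rewrite [RHS]integral_mkcond; apply: eq_integral => w _.
    rewrite /K /patch; have [wQ|wQ] := boolP (w \in Q).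
      rewrite mem_set//; split => /=; last by rewrite inE in wQ.
      by rewrite /I/= in_itv.
    rewrite memNset// => -[_ /=] /mem_set.
    by rewrite (negbTE wQ).
  have mGt r : measurable_fun setT (r : measurableTypeR R -> measurableTypeR R) ->
      measurable_fun Q (fun w => (G r (t, w))%:E).
    move=> mr; apply/measurable_EFinP; apply: measurable_funS (@subsetT _ _) _ => //.
    exact: (measurableT_comp (mG r mr) (mpair1 t)).
  rewrite ge0_integralD//; [|by move=> w _; rewrite lee_fin sqr_ge0|exact: mGt
    |by move=> w _; rewrite lee_fin sqr_ge0|exact: mGt].
  rewrite ge0_muleDr; [|by apply: integral_ge0 => w _; rewrite lee_fin sqr_ge0
    |by apply: integral_ge0 => w _; rewrite lee_fin sqr_ge0].
  rewrite (_ : 2%:E * H t = H t + H t)%E; last by rewrite mule_natl mule2n.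
  have t0 : 0 <= a * Num.sqrt t by rewrite mulr_ge0 ?sqrtr_ge0// ltW.
  apply: leeD; apply: half => //; rewrite ?normrN ger0_norm//.
have fiber w : Q w ->
    ((evalp p x ^+ 2 * b / N)%:E <= \int[lebesgue_measure]_t K (t, w))%E.
  move=> wQ.
  have [A [sA A0 AE]] := parabola_even_part x u (a *: embed_perp i u w) pn.
  have gap := endpoint_nikolskii_gap b0 (ltn0Sn n) sA.
  apply: (@le_trans _ _
    (\int[lebesgue_measure]_(t in I) ((2 *: A ^+ 2).[t])%:E)%E).
    rewrite integral_poly// pintZ lee_fin ler_pdivrMr// -A0.
    by rewrite [leRHS]mulrAC; exact: gap.
  rewrite [leLHS]integral_mkcond; apply: ge0_le_integral => //.
  - move=> t _; rewrite /patch; case: ifP => // _.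
    by rewrite hornerZ horner_exp lee_fin mulr_ge0// sqr_ge0.
  - apply/(measurable_restrictT _ mI)/measurable_EFinP.
    apply: measurable_funS (@subsetT _ _) _ => //.
    by apply: continuous_measurable_fun; exact: continuous_horner.
  - exact: (measurableT_comp mK (mpair2 w)).
  - move=> t _; rewrite /K /patch; have [tI|tI] := boolP (t \in I); last first.
      rewrite memNset// => -[/= /mem_set].
      by rewrite (negbTE tI).
    rewrite mem_set; last by split => //=; move: tI; rewrite inE.
    rewrite lee_fin hornerZ horner_exp.
    have t0 : 0 <= t.
      move: tI; rewrite inE /I/= in_itv/= => /andP[ht _].
      exact: le_trans (ltW h0) ht.
    have := AE (Num.sqrt t); rewrite sqr_sqrtr// !scalerA (mulrC _ a).
    rewrite /G /arc/= /rp /rm scaleNr.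
    set e1 := evalp _ _; set e2 := evalp _ _ => e12.
    (* [e1^2 + e2^2 >= (e1 + e2)^2 / 2], and [e1 + e2] is twice the even part. *)
    have := sqr_ge0 (e1 - e2).
    have -> : A.[t] = (e1 + e2) / 2 by rewrite e12; field.
    by nra.
have main : (J%:E * (evalp p x ^+ 2 * b / N)%:E <=
    2%:E * \int[lebesgue_rV R k.+1]_z F z)%E.
  apply: (@le_trans _ _ (2%:E * \int[lebesgue_measure]_t H t)%E); last first.
    rewrite lee_wpmul2l//.
    have := le_integral_embed_perp x uu ui mF F0.
    by under eq_integral do under eq_integral do rewrite -[embed_perp _ _ _]scale1r.
  rewrite -ge0_integralZl//.
  apply: (@le_trans _ _ (\int[lebesgue_measure]_t
      (J%:E * \int[lebesgue_rV R k]_w K (t, w)))%E); last first.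
    apply: ge0_le_integral => //.
    - by move=> t _; apply: mule_ge0; [rewrite lee_fin|apply: integral_ge0].
    - apply: measurable_funeM.
      exact: (@measurable_fun_fubini_tonelli_F _ _ _ _ _ (lebesgue_rV R k) K).
    - exact: measurable_funeM.
  rewrite ge0_integralZl//; last first.
    by move=> t _; apply: integral_ge0.
    exact: (@measurable_fun_fubini_tonelli_F _ _ _ _ _ (lebesgue_rV R k) K).
  rewrite lee_wpmul2l ?lee_fin//.
  rewrite (fubini_tonelli K)//.
  apply: (@le_trans _ _ (\int[lebesgue_rV R k]_(w in Q)
    \int[lebesgue_measure]_t K (t, w))%E); last first.
    apply: ge0_subset_integral => //.
      exact: (@measurable_fun_fubini_tonelli_G _ _ _ _ _ lebesgue_measure K).
    by move=> w _; apply: integral_ge0.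
  apply: (@le_trans _ _ (\int[lebesgue_rV R k]_(w in Q)
    (evalp p x ^+ 2 * b / N)%:E)%E).
    by rewrite integral_cst//= lebesgue_unit_cube mule1.
  apply: ge0_le_integral => //.
  - move=> w _; rewrite lee_fin; apply: divr_ge0; last exact: ltW.
    by apply: mulr_ge0; [exact: sqr_ge0|exact: ltW].
  - apply: measurable_funS (@subsetT _ _) _ => //.
    exact: (@measurable_fun_fubini_tonelli_G _ _ _ _ _ lebesgue_measure K).
rewrite [in leRHS]integral_mkcond -/F.
have -> : ((2 * N)%:E * \int[lebesgue_rV R k.+1]_z F z =
    N%:E * (2%:E * \int[lebesgue_rV R k.+1]_z F z))%E.
  by rewrite muleA -EFinM mulrC.
apply: le_trans (lee_wpmul2l _ main); last by rewrite lee_fin ltW.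
rewrite -!EFinM lee_fin le_eqVlt; apply/orP; left; apply/eqP.
by rewrite /J; field; rewrite gt_eqF.
Qed.

End ParaboloidEstimate.

(** * The paraboloid inside the horn *)

Section Horn.
Context {R : realType} {k : nat}.
Implicit Types (x u v z : 'rV[R]_k.+1).

Definition horn (beta1 beta2 s : R) x u : set 'rV[R]_k.+1 :=
  [set z | exists (delta lambda : R) (v : 'rV[R]_k.+1),
     [/\ 0 <= delta <= beta1, 0 <= lambda <= beta2, enorm v = 1, dotv u v = 0
       & z = x + delta *: u + (lambda * delta `^ s) *: v]].

Lemma enorm_normalize v : v != 0 -> enorm ((enorm v)^-1 *: v) = 1.
Proof.
move=> v0; have vv : 0 < dotv v v.
  rewrite lt_neqAle dotv_ge0 andbT eq_sym.
  by apply: contra_neq v0; exact: dotv_eq0.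
rewrite {1}/enorm dotvZl dotvZr mulrA -expr2 /enorm exprVn sqr_sqrtr ?dotv_ge0//.
by rewrite mulVf ?gt_eqF// sqrtr1.
Qed.

(** For [z = 0] a unit vector orthogonal to [u] is still needed; it exists because
the dimension is at least 2. *)
Lemma orthogonal_direction u i z : (0 < k)%N -> u ord0 i != 0 -> dotv u z = 0 ->
  exists v, [/\ enorm v = 1, dotv u v = 0 & z = enorm z *: v].
Proof.
move=> k0 ui uz; have [z0|z0] := eqVneq z 0; last first.
  exists ((enorm z)^-1 *: z); split; first exact: enorm_normalize.
    by rewrite dotvZr uz mulr0.
  rewrite scalerA mulfV ?scale1r// gt_eqF// sqrtr_gt0 lt_neqAle dotv_ge0 andbT.
  by rewrite eq_sym; apply: contra_neq z0; exact: dotv_eq0.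
pose f := embed_perp i u (const_mx 1 : 'rV[R]_k).
have f0 : f != 0.
  apply: contraTneq isT => /embed_perp_eq0 /rowP /(_ (Ordinal k0)).
  by rewrite !mxE => /eqP; rewrite oner_eq0.
exists ((enorm f)^-1 *: f); split; first exact: enorm_normalize.
  by rewrite dotvZr dotv_embed_perp// mulr0.
have -> : enorm z = 0 by rewrite z0 /enorm -(scale0r 0) dotvZl mul0r sqrtr0.
by rewrite scale0r.
Qed.

Lemma mem_horn beta1 beta2 s x u i t z : (0 < k)%N -> u ord0 i != 0 ->
  dotv u z = 0 -> 0 < t <= beta1 -> enorm z <= beta2 * t `^ s ->
  horn beta1 beta2 s x u (x + t *: u + z).
Proof.
move=> k0 ui uz /andP[t0 tb] zb.
have [v [v1 uv zE]] := orthogonal_direction k0 ui uz.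
have ts : 0 < t `^ s by exact: powR_gt0.
exists t, (enorm z / t `^ s), v; split => //.
- by rewrite (ltW t0).
- by rewrite ler_pdivrMr// zb andbT divr_ge0 ?sqrtr_ge0// ltW.
- by rewrite divfK ?gt_eqF// -zE.
Qed.

(** For [t >= h] and [s >= 1/2], [h^(s - 1/2) sqrt(t) <= t^s]; the division by
[(k + 1)^2] compensates the length of [embed_perp i u w]. *)
Lemma paraboloid_sub_horn beta1 beta2 s x u i (h t r : R) (w : 'rV[R]_k)
    (a := beta2 * h `^ (s - 2^-1) / k.+1%:R ^+ 2) :
  (0 < k)%N -> dotv u u = 1 -> 1 <= k.+1%:R * `|u ord0 i| ->
  0 <= beta2 -> 2^-1 <= s -> 0 < h -> h <= t <= beta1 ->
  `|r| = a * Num.sqrt t -> unit_cube w ->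
  horn beta1 beta2 s x u (x + t *: u + r *: embed_perp i u w).
Proof.
move=> k0 uu ui b2 s12 h0 /andP[ht tb] rE w01.
have t0 : 0 < t by exact: lt_le_trans ht.
have ui0 : u ord0 i != 0.
  by apply: contraTneq ui => ->; rewrite normr0 mulr0 ler10.
have k1 : 0 < k.+1%:R ^+ 2 :> R by rewrite exprn_gt0.
apply: (@mem_horn beta1 beta2 s x u i t) => //.
  by rewrite dotvZr dotv_embed_perp// mulr0.
  by rewrite t0.
have -> : enorm (r *: embed_perp i u w) = `|r| * enorm (embed_perp i u w).
  rewrite /enorm dotvZl dotvZr mulrA -expr2 sqrtrM ?sqr_ge0// sqrtr_sqr.
  by [].
have fr : enorm (embed_perp i u w) <= k.+1%:R ^+ 2.
  rewrite -[leRHS]ger0_norm ?(ltW k1)// -sqrtr_sqr ler_sqrt ?sqr_ge0// -exprM.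
  exact: dotv_embed_perp_le.
apply: (@le_trans _ _ (`|r| * k.+1%:R ^+ 2)); first by rewrite ler_wpM2l.
rewrite rE /a mulrAC divfK ?gt_eqF// -mulrA ler_wpM2l//.
rewrite -powR12_sqrt ?(ltW t0)//.
apply: (@le_trans _ _ (t `^ (s - 2^-1) * t `^ 2^-1)).
  rewrite ler_wpM2r ?powR_ge0//.
  by apply: ge0_ler_powR => //; rewrite ?nnegrE ?subr_ge0// ltW.
by rewrite -powRD ?subrK//; apply/implyP => _; rewrite gt_eqF.
Qed.

End Horn.

(** At the height [h ~ n^(-2)] where the paraboloid is truncated, the radius [h^s]
is at least of order [n^(-2 s)], uniformly in [s]. *)
Lemma powR_sample_scale (R : realType) (b s : R) n (h := b / (4 * n.+1%:R ^+ 2)) :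
  0 < b <= 1 -> 0 <= s <= 1 -> (0 < n)%N ->
  b / 16 <= h `^ s * n%:R `^ (2 * s).
Proof.
move=> /andP[b0 b1] /andP[s0 s1] n0.
have n1 : 1 <= n%:R :> R by rewrite ler1n.
have h0 : 0 < h by rewrite divr_gt0// mulr_gt0// exprn_gt0.
rewrite powRrM (_ : n%:R `^ 2 = n%:R ^+ 2); last by rewrite -powR_mulrn.
rewrite -powRM ?(ltW h0) ?sqr_ge0//.
have hn : b / 16 <= h * n%:R ^+ 2.
  rewrite /h mulrAC ler_pdivlMr; last by rewrite mulr_gt0// exprn_gt0.
  have m2 : n.+1%:R ^+ 2 <= 4 * n%:R ^+ 2 :> R.
    by rewrite -natr1; move: (n%:R : R) n1 => m; nra.
  have := ler_wpM2l (ltW b0) m2; lra.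
apply: (@le_trans _ _ ((b / 16) `^ s)).
  by apply: ger1_powR => //; apply/andP; split; lra.
apply: ge0_ler_powR => //; rewrite nnegrE; first by lra.
by apply: mulr_ge0; [exact: ltW|exact: sqr_ge0].
Qed.

(** * The bound on the Christoffel function *)

Theorem theorem5p3 (R : realType) (d : nat) (hd : (2 <= d)%N)
    (beta1 beta2 : R) (hbeta1 : 0 < beta1) (hbeta2 : 0 < beta2) :
  exists c : R,
    forall (D : set 'rV[R]_d) (x u : 'rV[R]_d) (s : R),
      compact D -> D x -> enorm u = 1 -> 2^-1 <= s <= 1 ->
      [set z | exists (delta lambda : R) (v : 'rV[R]_d),
          [/\ 0 <= delta <= beta1, 0 <= lambda <= beta2,
              enorm v = 1, dotv u v = 0
            & z = x + delta *: u + (lambda * delta `^ s) *: v]] `<=` D ->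
      forall n : nat, (1 <= n)%N ->
      forall y : R, is_christoffel n D x y ->
        y <= c * n%:R `^ (2 + 2 * s * (d%:R - 1)).
Proof.
case: d hd => [|k]//; rewrite ltnS => k0.
pose b := Num.min beta1 1; pose M : R := k.+1%:R ^+ 2.
have b0 : 0 < b by rewrite lt_min hbeta1 ltr01.
have b1 : b <= 1 by rewrite ge_min lexx orbT.
have M0 : 0 < M by rewrite exprn_gt0.
pose e := (beta2 / M * (b / 16)) ^+ k.
have e0 : 0 < e by rewrite exprn_gt0// mulr_gt0// divr_gt0.
exists (8 / (b * e)) => D x u s cD Dx u1 /andP[s12 s1] hornD n n0 y Hy.
have mD := compact_measurable_rV cD.
have uu : dotv u u = 1.
  by rewrite -(sqr_sqrtr (dotv_ge0 u)) -/(enorm u) u1 expr1n.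
have [i ui] := unit_large_coord uu.
have ui0 : u ord0 i != 0.
  by apply: contraTneq ui => ->; rewrite normr0 mulr0 ler10.
have [p [pn px pD]] := christoffel_extremal mD Hy.
pose h := b / (4 * n.+1%:R ^+ 2).
have h0 : 0 < h by rewrite divr_gt0// mulr_gt0// exprn_gt0.
pose a := beta2 * h `^ (s - 2^-1) / M.
have a0 : 0 < a by rewrite divr_gt0// mulr_gt0// powR_gt0.
have := integral_paraboloid_ge (x := x) uu ui0 mD pn a0 b0.
rewrite pD px -EFinM lee_fin -/h => /(_ _)/wrap[].
  move=> t r w /andP[ht tb] rE w01; apply: hornD.
  apply: paraboloid_sub_horn k0 uu ui (ltW hbeta2) s12 h0 _ rE w01.
  by rewrite ht (le_trans tb)// ge_min lexx.
have -> : a * Num.sqrt h = beta2 / M * h `^ s.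
  have -> : h `^ s = h `^ (s - 2^-1) * h `^ 2^-1.
    by rewrite -powRD ?subrK//; apply/implyP => _; rewrite gt_eqF.
  by rewrite powR12_sqrt ?(ltW h0)// /a; field; rewrite gt_eqF.
(* The estimate reads [J y^2 b <= 2 (n + 1)^2 y], to be divided by [y]. *)
have [y0|y0] := leP y 0 => est.
  apply: le_trans y0 _; rewrite mulr_ge0 ?powR_ge0// divr_ge0// ltW//.
  exact: mulr_gt0.
have := @powR_sample_scale _ b s n; rewrite b0 b1 s1 => /(_ isT _ n0)/wrap[].
  by rewrite andbT; lra.
rewrite -/h; set P := n%:R `^ (2 * s) => scale.
have P0 : 0 < P by rewrite powR_gt0// ltr0n.
have -> : n%:R `^ (2 + 2 * s * (k.+1%:R - 1)) = n%:R ^+ 2 * P ^+ k.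
  rewrite (_ : k.+1%:R - 1 = k%:R); last by rewrite -natr1 addrK.
  rewrite powRD; last by apply/implyP => _; rewrite pnatr_eq0 -lt0n.
  by rewrite powRrM -!powR_mulrn ?powR_ge0.
have eJ : e <= (beta2 / M * h `^ s) ^+ k * P ^+ k.
  rewrite -exprMn -(mulrA (beta2 / M)); apply: lerXn2r.
  - by rewrite nnegrE ltW// mulr_gt0// divr_gt0.
  - by rewrite nnegrE ltW// !mulr_gt0// ?invr_gt0// powR_gt0.
  - by rewrite ler_pM2l// divr_gt0.
move: eJ est; set J := (_ * _ `^ s) ^+ k => eJ est.
have n2 : n.+1%:R ^+ 2 <= 4 * n%:R ^+ 2 :> R.
  have : 1 <= n%:R :> R by rewrite ler1n.
  by rewrite -natr1; move: (n%:R : R) => m; nra.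
have est1 : J * (y * b) <= 2 * n.+1%:R ^+ 2.
  rewrite -(ler_pM2r y0); apply: le_trans est; rewrite expr2.
  by rewrite le_eqVlt; apply/orP; left; apply/eqP; ring.
rewrite mulrAC ler_pdivlMr ?mulr_gt0//.
have Pk0 : 0 < P ^+ k by rewrite exprn_gt0.
have H1 : y * b * e <= y * b * (J * P ^+ k) by rewrite ler_pM2l// mulr_gt0.
have H2 : J * (y * b) * P ^+ k <= 8 * n%:R ^+ 2 * P ^+ k.
  by rewrite ler_pM2r//; apply: le_trans est1 _; lra.
have -> : 8 * (n%:R ^+ 2 * P ^+ k) = 8 * n%:R ^+ 2 * P ^+ k by rewrite mulrA.
apply: le_trans H2; rewrite [leLHS]mulrA; apply: le_trans H1 _.
by rewrite le_eqVlt; apply/orP; left; apply/eqP; ring.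
Qed.
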